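(* Let $V^{r-1}\subset A^{r-1}(Y)\otimes\mathbb{R}$ be the subspace orthogonal to the canonical class $K$ under the intersection pairing $(-\cdot-)$ between $A^1(Y)$ and $A^{r-1}(Y)$. Then the action of the Weyl group on $V^{r-1}$ is isomorphic to the standard geometric representation of the Coxeter group of the graph $T_{2,r+1,s-r-1}$; and the dual space of $V^{r-1}$ is isomorphic to the quotient space $(A^1(Y)\otimes\mathbb{R})/\langle K\rangle$.
   Context: Let $r\ge 2$ and $s\ge r+3$ be integers. $Y=Y^r_s$ is the blowup of $\mathbb{P}^r$ at $s$ general points; its divisor class group $A^1(Y)$ is free with basis $H$ (pullback of the hyperplane class) and $E_1,\dots,E_s$ (exceptional divisors). Its curve class group $A^{r-1}(Y)$ is free with basis $h$ (class of a general line) and $e_1,\dots,e_s$ ($e_i$ the class of a line in $E_i$). The intersection pairing is $(H\cdot h)=1$, $(H\cdot e_i)=(E_i\cdot h)=0$, $(E_i\cdot e_j)=-\delta_{ij}$. The canonical class is $K=-(r+1)H+(r-1)\sum_i E_i$. For a subset $I\subset\{1,\dots,s\}$ with $|I|=r+1$, the Cremona action $\phi_I$ on $A^{r-1}(Y)$ sends $dh-\sum_i m_ie_i$ to $d'h-\sum_i m_i'e_i$ where, with $t=d-\sum_{i\in I}m_i$, $d'=d+(r-1)t$, $m_i'=m_i+t$ for $i\in I$ and $m_i'=m_i$ for $i\notin I$. Put $\phi=\phi_{\{1,\dots,r+1\}}$. The Weyl group is the group generated by $\phi$ and the symmetric group permuting $e_1,\dots,e_s$ (equivalently by the symmetric group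 and all $\phi_I$); it preserves $V^{r-1}$. The dual action on divisor classes is the corresponding Cremona action, which sends $dH-\sum m_iE_i$ to $d'H-\sum m_i'E_i$ with $t_1=(r-1)d-\sum_{i\in I}m_i$, $d'=d+t_1$, $m_i'=m_i+t_1$ for $i\in I$, $m_i'=m_i$ otherwise. The graph $T_{2,r+1,s-r-1}$ has vertices $0,1,\dots,s-1$, with edges $\{i,i+1\}$ for $1\le i\le s-2$ and $\{0,r+1\}$. Its Coxeter group $W$ has generators $w_0,\dots,w_{s-1}$ with relations $w_i^2=1$, $w_iw_j=w_jw_i$ if $i\ne j$ are not joined, $w_iw_jw_i=w_jw_iw_j$ if joined. The standard geometric representation is the action of $W$ on the real vector space with basis $x_0,\dots,x_{s-1}$ where $w_i$ acts by $x\mapsto x-2B(x,x_i)x_i$, with $B$ the symmetric bilinear form given by $B(x_i,x_i)=1$, $B(x_i,x_j)=-1/2$ if $i,j$ are joined and $0$ if $i\neq j$ are not joined. Under the isomorphism of actions, $w_0$ corresponds to $\phi$ and $w_i$ ($i\ge1$) to the transposition $(i,i+1)$. *)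

(* Defs.v *)
From HB Require Import structures.
From mathcomp Require Import all_boot all_order all_fingroup all_algebra.
From mathcomp Require Import boolp reals.
From mathcomp Require Import ring lra.
Import generic_quotient.

Set Implicit Arguments.
Unset Strict Implicit.
Unset Printing Implicit Defensive.

Import GRing.Theory Num.Theory.
Local Open Scope ring_scope.
Local Open Scope quotient_scope.

(* ---- Groups given by generators and relations ---- *)

(* The letter (i, false) is the generator i and (i, true) is its inverse. *)
Definition word (I : Type) : Type := seq (I * bool).
HB.instance Definition _ (I : choiceType) := Choice.on (word I).

Definition letters (I : Type) (s : seq I) : word I := [seq (i, false) | i <- s].

Inductive pres_eqv (I : Type) (rels : word I -> word I -> Prop) :
    word I -> word I -> Prop :=
| pres_refl u : pres_eqv rels u u
| pres_sym u v : pres_eqv rels u v -> pres_eqv rels v u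
| pres_trans u v w :
    pres_eqv rels u v -> pres_eqv rels v w -> pres_eqv rels u w
| pres_cat u u' v v' :
    pres_eqv rels u u' -> pres_eqv rels v v' -> pres_eqv rels (u ++ v) (u' ++ v')
| pres_cancel i b : pres_eqv rels [:: (i, b); (i, ~~ b)] [::]
| pres_base u v : rels u v -> pres_eqv rels u v.

Section PresentedGroup.
Variables (I : choiceType) (rels : word I -> word I -> Prop).

Definition pres_rel : rel (word I) := fun u v => `[< pres_eqv rels u v >].

Lemma pres_rel_equiv : equiv_class_of pres_rel.
Proof.
split=> [u|u v|v u w].
- by apply/asboolP; apply: pres_refl.
- by apply/asboolP/asboolP; apply: pres_sym.
- by move=> /asboolP uv /asboolP vw; apply/asboolP; apply: pres_trans uv vw.
Qed.

Canonical pres_rel_equivRel := EquivRelPack pres_rel_equiv.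
Canonical pres_rel_encModRel := defaultEncModRel pres_rel.

Definition presented : Type := {eq_quot pres_rel}.
HB.instance Definition _ : EqQuotient (word I) pres_rel presented :=
  EqQuotient.on presented.
HB.instance Definition _ := Choice.on presented.

Definition pres_class (u : word I) : presented := \pi_presented u.

Lemma pres_classP u v : pres_class u = pres_class v <-> pres_eqv rels u v.
Proof.
rewrite /pres_class; split=> [/eqP|uv]; first by rewrite piE => /asboolP.
by apply/eqP; rewrite piE; apply/asboolP.
Qed.

Lemma pres_reprK (x : presented) : pres_class (repr x) = x.
Proof. exact: reprK. Qed.

Definition word_inv (u : word I) : word I := rev [seq (p.1, ~~ p.2) | p <- u].

Definition pres_one : presented := pres_class [::].
Definition pres_mul (x y : presented) : presented :=
  pres_class (repr x ++ repr y).
Definition pres_inv (x : presented) : presented :=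
  pres_class (word_inv (repr x)).

Lemma pres_mulE u v : pres_mul (pres_class u) (pres_class v) = pres_class (u ++ v).
Proof. by apply/pres_classP; apply: pres_cat; apply/pres_classP; rewrite pres_reprK. Qed.

Lemma word_invK u : pres_eqv rels (u ++ word_inv u) [::].
Proof.
elim: u => [|[i b] u IH]; first exact: pres_refl.
rewrite /word_inv /= rev_cons -cats1 -/(word_inv u).
have -> : (i, b) :: u ++ (word_inv u ++ [:: (i, ~~ b)]) =
    [:: (i, b)] ++ ((u ++ word_inv u) ++ [:: (i, ~~ b)]) by rewrite -catA.
apply: pres_trans (pres_cancel rels i b).
pose p := [:: (i, b)]; pose q := [:: (i, ~~ b)].
apply: (@pres_cat _ _ p p _ q); first exact: pres_refl.
by apply: (@pres_cat _ _ _ [::] q q) => //; apply: pres_refl.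
Qed.

Lemma word_inv_inv u : word_inv (word_inv u) = u.
Proof.
rewrite /word_inv map_rev revK -map_comp -[RHS]map_id.
by apply: eq_map => -[i b] /=; rewrite negbK.
Qed.

Lemma pres_mulA : associative pres_mul.
Proof.
move=> x y z; rewrite -(pres_reprK x) -(pres_reprK y) -(pres_reprK z).
by rewrite !pres_mulE catA.
Qed.
Lemma pres_mul1 : left_id pres_one pres_mul.
Proof. by move=> x; rewrite -(pres_reprK x) pres_mulE. Qed.
Lemma pres_mulr1 : right_id pres_one pres_mul.
Proof. by move=> x; rewrite -(pres_reprK x) pres_mulE cats0. Qed.
Lemma pres_mulV : left_inverse pres_one pres_inv pres_mul.
Proof.
move=> x; rewrite -{2}(pres_reprK x) pres_mulE; apply/pres_classP.
by rewrite -{2}(word_inv_inv (repr x)); apply: word_invK.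
Qed.
Lemma pres_mulrV : right_inverse pres_one pres_inv pres_mul.
Proof.
move=> x; rewrite -{1}(pres_reprK x) pres_mulE; apply/pres_classP.
exact: word_invK.
Qed.

HB.instance Definition _ :=
  isGroup.Build presented pres_mulA pres_mul1 pres_mulr1 pres_mulV pres_mulrV.

Definition pres_gen (i : I) : presented := pres_class (letters [:: i]).

Section Lift.
Variables (G : groupType) (f : I -> G).
Local Open Scope group_scope.

Definition word_eval (u : word I) : G :=
  foldr (fun p g => (if p.2 then (f p.1)^-1 else f p.1) * g) 1 u.

(* The homomorphism sending generator i to f i; it is well defined when f
   satisfies the relations, see pres_lift_class. *)
Definition pres_lift (x : presented) : G := word_eval (repr x).

Lemma word_eval_cat u v : word_eval (u ++ v) = word_eval u * word_eval v.
Proof. by elim: u => [|p u /= ->]; rewrite ?mul1g ?mulgA. Qed.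

Hypothesis f_rels : forall u v, rels u v -> word_eval u = word_eval v.

Lemma word_eval_eqv u v : pres_eqv rels u v -> word_eval u = word_eval v.
Proof.
elim=> {u v} //=; first by move=> u v w _ -> _ ->.
- by move=> u u' v v' _ IHu _ IHv; rewrite !word_eval_cat IHu IHv.
- by move=> i [] /=; rewrite mulg1 ?mulVg ?mulgV.
Qed.

Lemma pres_lift_class u : pres_lift (pres_class u) = word_eval u.
Proof. by apply/word_eval_eqv/pres_classP; rewrite pres_reprK. Qed.

Lemma pres_liftM : {morph pres_lift : x y / x * y}.
Proof.
move=> x y; rewrite -(pres_reprK x) -(pres_reprK y) [_ * _]pres_mulE.
by rewrite !pres_lift_class word_eval_cat.
Qed.

Lemma pres_lift_gen i : pres_lift (pres_gen i) = f i.
Proof. by rewrite pres_lift_class /= mulg1. Qed.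

End Lift.
End PresentedGroup.

(* ---- Subgroups generated by a set, and general linear groups ---- *)

Inductive generated (G : groupType) (S : G -> Prop) : G -> Prop :=
| generated_in g : S g -> generated S g
| generated_one : generated S 1%g
| generated_mul g h : generated S g -> generated S h -> generated S (g * h)%g
| generated_inv g : generated S g -> generated S (g^-1)%g.

Section GeneralLinear.
Variables (K : fieldType) (V : vectType K).

Record GL : Type := MkGL { GLval :> 'End(V); _ : lker GLval == 0%VS }.
HB.instance Definition _ := [isSub for GLval].
HB.instance Definition _ := [Choice of GL by <:].

Lemma GL_ker (g : GL) : lker g == 0%VS. Proof. by case: g. Qed.

Lemma GL_one_subproof : lker (\1%VF : 'End(V)) == 0%VS.
Proof. by apply/lker0P => u v; rewrite !lfunE. Qed.
Lemma GL_mul_subproof (g h : GL) : lker (g \o h)%VF == 0%VS.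
Proof.
apply/lker0P => u v; rewrite !lfunE /= => /(lker0P (GL_ker g)).
exact: (lker0P (GL_ker h)).
Qed.
Lemma GL_inv_subproof (g : GL) : lker (g^-1)%VF == 0%VS.
Proof. by apply/lker0P; apply: can_inj (lker0_lfunVK (GL_ker g)). Qed.

Definition GL_one := MkGL GL_one_subproof.
Definition GL_mul g h := MkGL (GL_mul_subproof g h).
Definition GL_inv g := MkGL (GL_inv_subproof g).

Lemma GL_mulA : associative GL_mul.
Proof. by move=> f g h; apply/val_inj; rewrite /= comp_lfunA. Qed.
Lemma GL_mul1 : left_id GL_one GL_mul.
Proof. by move=> g; apply/val_inj; rewrite /= comp_lfun1l. Qed.
Lemma GL_mulr1 : right_id GL_one GL_mul.
Proof. by move=> g; apply/val_inj; rewrite /= comp_lfun1r. Qed.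
Lemma GL_mulV : left_inverse GL_one GL_inv GL_mul.
Proof. by move=> g; apply/val_inj; rewrite /= lker0_compVf ?GL_ker. Qed.
Lemma GL_mulrV : right_inverse GL_one GL_inv GL_mul.
Proof. by move=> g; apply/val_inj; rewrite /= lker0_compfV ?GL_ker. Qed.

HB.instance Definition _ :=
  isGroup.Build GL GL_mulA GL_mul1 GL_mulr1 GL_mulV GL_mulrV.

Lemma GL_mulE (g h : GL) v : (g * h)%g v = g (h v).
Proof. exact: comp_lfunE. Qed.

Lemma GL_eqP (g h : GL) : g =1 h -> g = h.
Proof. by move=> gh; apply/val_inj/lfunP. Qed.

End GeneralLinear.

(* ---- Simply laced Coxeter groups and their geometric representation ---- *)

Section Coxeter.
Variables (s : nat) (adj : rel 'I_s).

Inductive coxeter_rel : word 'I_s -> word 'I_s -> Prop :=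
| coxeter_invol i : coxeter_rel (letters [:: i; i]) [::]
| coxeter_comm i j : i != j -> ~~ adj i j ->
    coxeter_rel (letters [:: i; j]) (letters [:: j; i])
| coxeter_braid i j : adj i j ->
    coxeter_rel (letters [:: i; j; i]) (letters [:: j; i; j]).

Definition coxeter_group : groupType := presented coxeter_rel.
Definition coxeter_gen (i : 'I_s) : coxeter_group := pres_gen coxeter_rel i.

Variable R : realType.

Definition coxeter_mx : 'M[R]_s :=
  \matrix_(i, j) (if i == j then 1 else if adj i j then - 2^-1 else 0).

Definition coxeter_form (x y : 'rV[R]_s) : R := (x *m coxeter_mx *m y^T) 0 0.

Definition simple_root (i : 'I_s) : 'rV[R]_s := delta_mx 0 i.

Definition reflection_fun (i : 'I_s) (x : 'rV[R]_s) : 'rV[R]_s :=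
  x - (2 * coxeter_form x (simple_root i)) *: simple_root i.

Lemma coxeter_form_linear a (u v y : 'rV[R]_s) :
  coxeter_form (a *: u + v) y = a * coxeter_form u y + coxeter_form v y.
Proof.
by rewrite /coxeter_form !mulmxDl -!scalemxAl !mxE.
Qed.

Lemma coxeter_form_root i j :
  coxeter_form (simple_root i) (simple_root j) = coxeter_mx i j.
Proof.
by rewrite /coxeter_form /simple_root -rowE trmx_delta -colE !mxE.
Qed.

Lemma reflection_fun_linear i : linear (reflection_fun i).
Proof.
move=> a u v; rewrite /reflection_fun coxeter_form_linear.
by rewrite scalerBr scalerA mulrDr scalerDl opprD addrACA mulrCA.
Qed.
HB.instance Definition _ i :=
  GRing.isLinear.Build R 'rV[R]_s 'rV[R]_s _ (reflection_fun i)
    (reflection_fun_linear i).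

Lemma reflection_fun_invol i : involutive (reflection_fun i).
Proof.
move=> x; rewrite {1}/reflection_fun.
set c := coxeter_form x (simple_root i).
have -> : coxeter_form (reflection_fun i x) (simple_root i) = - c.
  rewrite /reflection_fun -/c addrC -scaleNr.
  rewrite coxeter_form_linear coxeter_form_root mxE eqxx -/c; ring.
by rewrite mulrN scaleNr opprK subrK.
Qed.

Lemma reflection_subproof i : lker (linfun (reflection_fun i)) == 0%VS.
Proof.
by apply/lker0P => u v; rewrite !lfunE /=; apply: (inv_inj (reflection_fun_invol i)).
Qed.

Definition reflection (i : 'I_s) : GL 'rV[R]_s := MkGL (reflection_subproof i).

Definition geom_rep : coxeter_group -> GL 'rV[R]_s :=
  @pres_lift _ coxeter_rel _ reflection.

Lemma reflectionE i x : reflection i x = reflection_fun i x.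
Proof. by rewrite lfunE. Qed.

Hypotheses (adj_sym : symmetric adj) (adj_irr : irreflexive adj).

Lemma reflection_rels u v : coxeter_rel u v ->
  word_eval reflection u = word_eval reflection v.
Proof.
have rE i x : reflection_fun i x =
    (- (2 * coxeter_form x (simple_root i))) *: simple_root i + x.
  by rewrite /reflection_fun addrC scaleNr.
case=> [i|i j ij nij|i j ij]; apply: GL_eqP => x /=;
  rewrite !comp_lfunE !lfunE /=.
- by rewrite reflection_fun_invol.
- rewrite !(rE, coxeter_form_linear) !coxeter_form_root !mxE.
  rewrite [j == i]eq_sym [adj j i]adj_sym (negbTE ij) (negbTE nij).
  by rewrite !mulr0 !add0r addrCA.
- have ij' : (i == j) = false.
    by apply/eqP => e; move: ij; rewrite e adj_irr.
  rewrite !(rE, coxeter_form_linear) !coxeter_form_root !mxE !eqxx.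
  rewrite ![j == i]eq_sym ![adj j i]adj_sym ij' ij.
  set a := coxeter_form x _; set b := coxeter_form x _.
  move: (simple_root i) (simple_root j) => p q.
  by apply/rowP => k; rewrite !mxE; field.
Qed.

Lemma geom_repM : {morph geom_rep : u v / (u * v)%g}.
Proof. exact: pres_liftM reflection_rels. Qed.

Lemma geom_rep_gen i : geom_rep (coxeter_gen i) = reflection i.
Proof. exact: pres_lift_gen reflection_rels i. Qed.

End Coxeter.

Definition T_edge (r s : nat) (i j : 'I_s) : bool :=
  (1 <= i)%N && (j == i.+1 :> nat) || (i == 0 :> nat) && (j == r.+1 :> nat).

(* The graph T_{2,r+1,s-r-1}. *)
Definition T_adj (r s : nat) : rel 'I_s := fun i j => T_edge r i j || T_edge r j i.

Lemma T_adj_sym r s : symmetric (T_adj r (s := s)).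
Proof. by move=> i j; rewrite /T_adj orbC. Qed.

Lemma T_adj_irr r s : irreflexive (T_adj r (s := s)).
Proof.
move=> i; rewrite /T_adj orbb /T_edge -[i.+1]addn1.
by apply/negbTE; apply/negP => /orP[/andP[_ /eqP]|/andP[/eqP-> //]]; rewrite addn1 => /n_Sn.
Qed.

(* ---- Divisor and curve classes with real coefficients ---- *)

(* As in dH - sum_i m_i E_i and dh - sum_i m_i e_i, a class is recorded by its
   coordinates (d, m); in particular E_i has m = - delta_i.  The index i : 'I_s
   stands for i + 1 in {1, ..., s}. *)
Definition divisor (R : realType) (s : nat) : vectType R := (R^o * 'rV[R]_s)%type.
Definition curve (R : realType) (s : nat) : vectType R := (R^o * 'rV[R]_s)%type.

Section Classes.
Variables (R : realType) (r s : nat).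
Local Notation divisor := (divisor R s).
Local Notation curve := (curve R s).

Definition divH : divisor := (1, 0).
Definition divE (i : 'I_s) : divisor := (0, - delta_mx 0 i).
Definition curveh : curve := (1, 0).
Definition curvee (i : 'I_s) : curve := (0, - delta_mx 0 i).

Definition pairing (D : divisor) (C : curve) : R^o :=
  D.1 * C.1 - \sum_i D.2 0 i * C.2 0 i.

Definition canonical_class : divisor :=
  - (r.+1)%:R *: divH + r.-1%:R *: \sum_i divE i.

Lemma pair_coord (d : R) (m : 'rV[R]_s) :
  ((d, m) = d *: divH - \sum_i m 0 i *: divE i :> divisor) *
  ((d, m) = d *: curveh - \sum_i m 0 i *: curvee i :> curve).
Proof.
suff H : ((d, m) = d *: divH - \sum_i m 0 i *: divE i :> divisor) by split.
have E : \sum_i m 0 i *: divE i = (0, - m).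
  rewrite {2}(row_sum_delta m) -sumrN.
  apply: (big_ind2 (fun (x : divisor) y => x = (0, y))) => //.
    by move=> ? y1 ? y2 -> ->; congr pair; rewrite addr0.
  by move=> i _; congr pair; rewrite /= ?scaler0 ?scalerN.
rewrite E; congr pair; rewrite /= ?scaler0 ?opprK ?add0r //.
by rewrite subr0 [_ *: _]mulr1.
Qed.

Lemma pairing_Hh : pairing divH curveh = 1.
Proof. by rewrite /pairing big1 ?mulr1 ?subr0 // => i _; rewrite mxE mul0r. Qed.
Lemma pairing_He i : pairing divH (curvee i) = 0.
Proof. by rewrite /pairing big1 ?mulr0 ?subr0 // => j _; rewrite mxE mul0r. Qed.
Lemma pairing_Eh i : pairing (divE i) curveh = 0.
Proof. by rewrite /pairing big1 ?mul0r ?subr0 // => j _; rewrite [X in _ * X]mxE mulr0. Qed.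
Lemma pairing_Ee i j : pairing (divE i) (curvee j) = - (i == j)%:R.
Proof.
rewrite /pairing /= mul0r sub0r (bigD1 j) //= big1 ?addr0 => [|k kj].
  by rewrite !mxE !eqxx mulrNN mulr1 eq_sym.
by rewrite !mxE eqxx (negbTE kj) oppr0 mulr0.
Qed.

Lemma pairing_is_linear (D : divisor) : linear (pairing D).
Proof.
move=> a u v; rewrite /pairing /= scalerBr mulrDr -addrA -[RHS]addrA.
congr (_ + _); first by rewrite [in RHS]/(_ *: _) /= mulrCA.
rewrite [RHS]addrCA; congr (_ + _).
rewrite scaler_sumr -opprD -big_split /=; congr (- _); apply: eq_bigr => i _.
by rewrite !mxE mulrDr [in RHS]/(_ *: _) /= mulrCA.
Qed.
HB.instance Definition _ (D : divisor) :=
  GRing.isLinear.Build R curve R^o _ (pairing D) (pairing_is_linear D).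

(* The subspace V^{r-1} of curve classes C with (K . C) = 0. *)
Definition Kperp : {vspace curve} := lker (linfun (pairing canonical_class)).

Lemma KperpP C : reflect (pairing canonical_class C = 0) (C \in Kperp).
Proof. by rewrite memv_ker lfunE; apply: eqP. Qed.

Definition cremona_curve (I : {set 'I_s}) (C : curve) : curve :=
  let t := C.1 - \sum_(i in I) C.2 0 i in
  (C.1 + r.-1%:R * t, \row_i (C.2 0 i + (if i \in I then t else 0))).

Definition cremona_divisor (I : {set 'I_s}) (D : divisor) : divisor :=
  let t := r.-1%:R * D.1 - \sum_(i in I) D.2 0 i in
  (D.1 + t, \row_i (D.2 0 i + (if i \in I then t else 0))).

(* The permutation sigma sends e_i to e_(sigma i) and E_i to E_(sigma i). *)
Definition perm_curve (sigma : 'S_s) (C : curve) : curve :=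
  (C.1, \row_i C.2 0 ((sigma^-1)%g i)).
Definition perm_divisor (sigma : 'S_s) (D : divisor) : divisor :=
  (D.1, \row_i D.2 0 ((sigma^-1)%g i)).

Lemma perm_curvee sigma i : perm_curve sigma (curvee i) = curvee (sigma i).
Proof.
congr pair; apply/rowP => j; rewrite !mxE /=; congr (- (_%:R)).
by rewrite -(inj_eq (@perm_inj _ sigma)) permKV.
Qed.
Lemma perm_divE sigma i : perm_divisor sigma (divE i) = divE (sigma i).
Proof. exact: perm_curvee. Qed.

Definition first_points : {set 'I_s} := [set i : 'I_s | (i < r.+1)%N].

Definition weyl_generator (g : GL curve) : Prop :=
  (forall C, g C = cremona_curve first_points C) \/
  (exists sigma : 'S_s, forall C, g C = perm_curve sigma C).

Definition weyl_group : GL curve -> Prop := generated weyl_generator.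

End Classes.

(* ---- Quotient of a vector space by a subspace ---- *)

Section QuotientSpace.
Variables (K : fieldType) (V : vectType K) (U : {vspace V}).

Definition quot_space : Type := {ideal_quot U}.
HB.instance Definition _ := GRing.Zmodule.on quot_space.

Definition quot_class (v : V) : quot_space := \pi_({ideal_quot U}) v.

Lemma quot_classP u v : (quot_class u == quot_class v) = (u - v \in U).
Proof. by rewrite Quotient.idealrBE. Qed.

Lemma quot_reprK (x : quot_space) : quot_class (repr x) = x.
Proof. exact: (reprK (x : {ideal_quot U})). Qed.

Lemma quot_classD u v : quot_class (u + v) = quot_class u + quot_class v.
Proof. by rewrite /quot_class !piE. Qed.

Definition quot_scale (a : K) (x : quot_space) : quot_space :=
  quot_class (a *: repr x).

Lemma quot_scaleE a v : quot_scale a (quot_class v) = quot_class (a *: v).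
Proof.
apply/eqP; rewrite quot_classP -scalerBr; apply: memvZ.
by rewrite -quot_classP quot_reprK.
Qed.

Lemma quot_scalerA a b x : quot_scale a (quot_scale b x) = quot_scale (a * b) x.
Proof. by rewrite -(quot_reprK x) !quot_scaleE scalerA. Qed.
Lemma quot_scale1r : left_id 1 quot_scale.
Proof. by move=> x; rewrite -(quot_reprK x) quot_scaleE scale1r. Qed.
Lemma quot_scalerDr : right_distributive quot_scale +%R.
Proof.
move=> a x y; rewrite -(quot_reprK x) -(quot_reprK y) -quot_classD !quot_scaleE.
by rewrite scalerDr quot_classD.
Qed.
Lemma quot_scalerDl x : {morph quot_scale^~ x : a b / a + b}.
Proof.
by move=> a b; rewrite -(quot_reprK x) !quot_scaleE scalerDl quot_classD.
Qed.

HB.instance Definition _ := GRing.Zmodule_isLmodule.Build K quot_space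
  quot_scalerA quot_scale1r quot_scalerDr quot_scalerDl.

End QuotientSpace.

(* Main.v *)
From HB Require Import structures.
Require Import Defs.
From mathcomp Require Import all_boot all_order all_fingroup all_algebra.
From mathcomp Require Import boolp reals.
From mathcomp Require Import zify ring.

(** The Weyl group is generated by reflections of the curve class group.  The
    Cremona action is C |-> C + (C . b_0) a_0, with a_0 = (r-1)h - sum_I e_i
    and b_0 = H - sum_I E_i, where I is the set of the first r+1 points; the
    transposition (k, i), with i = k+1, is C |-> C + (C . b_i) a_i with
    a_i = e_k - e_i and b_i = E_k - E_i.  The only computation with the
    graph is the Gram matrix (b_i . a_j) = -2 B(x_i, x_j)
    ([class_root_gram]).

    Reflections with such a Gram matrix satisfy the Coxeter relations, so they
    define a representation of the Coxeter group, and x_i |-> a_i intertwines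
    the geometric representation with it ([root_comb_equivariant]).  The a_i
    are independent and lie in the orthogonal of K, which has dimension s, so
    x_i |-> a_i is an isomorphism onto it ([root_iso_bij]).  The image of the
    representation is the whole Weyl group because adjacent transpositions
    generate the symmetric group ([weyl_group_curve_rep]).

    That the abstract Coxeter group, and not a quotient of it, acts is the
    theorem of Tits that the geometric representation is faithful
    ([geom_rep_faithful]).  It follows from [positive_root]: if multiplying w
    by s_i on the right does not shorten w, then w x_i has nonnegative
    coordinates.  Any w other than 1 is v s_j with v shorter than w; then
    w x_j = - v x_j, where v x_j has nonnegative coordinates, so w does not
    fix x_j.

    For the dual space, the intersection pairing is perfect, so every
    functional on the orthogonal of K is the pairing with a divisor class, and
    the classes that pair to zero with that orthogonal are the multiples of K
    ([quot_pairing_bij]).  Each Cremona action or permutation of divisor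
    classes is compatible with that of curve classes because together they
    preserve the pairing ([cremona_pairing], [perm_pairing]). *)

Set Implicit Arguments.
Unset Strict Implicit.
Unset Printing Implicit Defensive.

Import Order.TTheory GRing.Theory Num.Theory.
Local Open Scope ring_scope.

(** * Word length in a Coxeter group *)

Section CoxeterLength.
Variables (s : nat) (adj : rel 'I_s).
Local Notation W := (coxeter_group adj).
Local Notation g := (coxeter_gen adj).
Local Open Scope group_scope.

(** The generators are involutions, so words without inverse letters represent
    every element ([gen_prod_surj]). *)
Definition gen_prod (u : seq 'I_s) : W := pres_class (coxeter_rel adj) (letters u).

Lemma gen_prod_cat u v : gen_prod (u ++ v) = gen_prod u * gen_prod v.
Proof. by rewrite [RHS]pres_mulE /letters -map_cat. Qed.

Lemma gen_prod_rcons u i : gen_prod (rcons u i) = gen_prod u * g i.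
Proof. by rewrite -cats1 gen_prod_cat. Qed.

Lemma coxeter_gen_sq i : g i * g i = 1.
Proof.
rewrite [LHS]pres_mulE; apply/pres_classP/pres_base.
exact: (coxeter_invol adj i).
Qed.

Lemma coxeter_genK i (w : W) : w * g i * g i = w.
Proof. by rewrite -mulgA coxeter_gen_sq mulg1. Qed.

Lemma coxeter_gen_comm i j : i != j -> ~~ adj i j -> g i * g j = g j * g i.
Proof.
move=> ij nij; rewrite [LHS]pres_mulE [RHS]pres_mulE.
by apply/pres_classP/pres_base; apply: (coxeter_comm ij nij).
Qed.

Lemma coxeter_gen_braid i j : adj i j -> g i * g j * g i = g j * g i * g j.
Proof.
have E a b c : g a * g b * g c = gen_prod [:: a; b; c].
  by rewrite (gen_prod_rcons [:: a; b]) (gen_prod_rcons [:: a]).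
by move=> ij; rewrite !E; apply/pres_classP/pres_base; apply: coxeter_braid ij.
Qed.

Lemma gen_prod_surj (w : W) : exists u, gen_prod u = w.
Proof.
rewrite -(pres_reprK w); elim: (generic_quotient.repr w) => [|[i b] u [v IH]].
  by exists [::].
exists (i :: v); have -> : i :: v = [:: i] ++ v by [].
rewrite gen_prod_cat IH.
have -> : (i, b) :: u = [:: (i, b)] ++ u by [].
rewrite -pres_mulE; congr (pres_mul _ _).
case: b => //; apply: (mulgI (g i)).
rewrite [LHS]coxeter_gen_sq [RHS]pres_mulE.
exact/esym/pres_classP/pres_cancel.
Qed.

Lemma coxeter_length_ex (w : W) :
  exists n, `[< exists2 u, size u = n & gen_prod u = w >].
Proof.
by have [u uw] := gen_prod_surj w; exists (size u); apply/asboolP; exists u.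
Qed.

Definition coxeter_length w := ex_minn (coxeter_length_ex w).
Local Notation len := coxeter_length.

Lemma coxeter_length_min u : (len (gen_prod u) <= size u)%N.
Proof.
by rewrite /len; case: ex_minnP => n _; apply; apply/asboolP; exists u.
Qed.

Lemma coxeter_length_word w : exists2 u, size u = len w & gen_prod u = w.
Proof. by rewrite /len; case: ex_minnP => n /asboolP. Qed.

Lemma coxeter_length_mul_gen w i : (len (w * g i) <= (len w).+1)%N.
Proof.
have [u <- uw] := coxeter_length_word w.
by rewrite -{1}uw -gen_prod_rcons -(size_rcons u i) coxeter_length_min.
Qed.

Lemma coxeter_descent w : w != 1 -> exists j, (len (w * g j) < len w)%N.
Proof.
have [u su uw] := coxeter_length_word w.
case/lastP: u su uw => [|u j] su uw; first by rewrite -uw eqxx.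
exists j; rewrite -su -uw gen_prod_rcons coxeter_genK size_rcons ltnS.
exact: coxeter_length_min.
Qed.

End CoxeterLength.

(** * Faithfulness of the geometric representation *)

Section Faithfulness.
Variables (R : realType) (s : nat) (adj : rel 'I_s).
Hypotheses (adj_sym : symmetric adj) (adj_irr : irreflexive adj).
Local Notation W := (coxeter_group adj).
Local Notation g := (coxeter_gen adj).
Local Notation len := (@coxeter_length s adj).
Local Notation root := (simple_root R).
Local Notation act := (geom_rep (adj := adj) R).

Lemma geom_rep1 : act 1%g = 1%g.
Proof. by apply: (mulgI (act 1%g)); rewrite -geom_repM // !mulg1. Qed.

Lemma geom_rep_mul_gen (w : W) i x :
  act (w * g i)%g x = act w (reflection_fun adj i x).
Proof. by rewrite geom_repM // GL_mulE geom_rep_gen // reflectionE. Qed.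

Lemma reflection_root i j :
  reflection_fun adj i (root j) = root j - (2 * coxeter_mx adj R j i) *: root i.
Proof. by rewrite /reflection_fun coxeter_form_root. Qed.

Definition positive_vector (x : 'rV[R]_s) := forall k, 0 <= x 0 k.

(** Strong induction on the length of w.  If w is not 1, write w = w' s_j with
    w' shorter; then j is not i, and s_j x_i lies in the span of x_i and x_j,
    so w x_i is w' x_i or w' (x_i + x_j).  The lemma applies to w' and j, and
    to w' and i unless s_i shortens w'.  Shortening is impossible when s_i and
    s_j commute; otherwise w' = w'' s_i and w' (x_i + x_j) = w'' x_j.  In every
    case a failure of the length hypothesis would, by the commutation or braid
    relation, give a word for w s_i that is shorter than w. *)
Lemma positive_root (w : W) i :
  (len w <= len (w * g i)%g)%N -> positive_vector (act w (root i)).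
Proof.
have [n] := ubnP (len w); elim: n w i => // n IH w i; rewrite ltnS => wn wi.
have [w1|/coxeter_descent[j wj]] := eqVneq w 1%g.
  by move=> k; rewrite w1 geom_rep1 lfunE mxE ler0n.
have ij : i != j by apply: contraTneq wi => ->; rewrite -ltnNge.
have [w' Ew w'w] : exists2 w', w = (w' * g j)%g & (len w' < len w)%N.
  by exists (w * g j)%g; rewrite ?coxeter_genK.
have w'n : (len w' < n)%N by apply: leq_trans w'w wn.
have lenS v k := coxeter_length_mul_gen (adj := adj) v k.
rewrite [in act w _]Ew geom_rep_mul_gen reflection_root mxE (negbTE ij).
case: (boolP (adj i j)) => aij; last first.
  rewrite mulr0 scale0r subr0; apply: IH => //.
  rewrite leqNgt; apply/negP => w'i.
  have := lenS (w' * g i)%g j; rewrite -mulgA coxeter_gen_comm // mulgA -Ew.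
  move=> wi'; have := leq_trans (leq_trans wi wi') w'i.
  by rewrite leqNgt w'w.
have -> : 2 * - 2^-1 = -1 :> R by field.
rewrite scaleN1r opprK.
have [w'i|w'i] := leqP (len w') (len (w' * g i)%g).
  move=> k; rewrite linearD mxE; apply: addr_ge0; apply: IH => //.
  by rewrite -Ew ltnW.
have [w'' Ew' w''w'] : exists2 w'', w' = (w'' * g i)%g & (len w'' < len w')%N.
  by exists (w' * g i)%g; rewrite ?coxeter_genK.
(* w' (x_i + x_j) = w'' s_i s_i x_j *)
have -> : root i + root j = reflection_fun adj i (root j).
  rewrite reflection_root mxE eq_sym (negbTE ij) adj_sym aij.
  have -> : 2 * - 2^-1 = -1 :> R by field.
  by rewrite scaleN1r opprK addrC.
rewrite Ew' -geom_rep_mul_gen coxeter_genK; apply: IH.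
  exact: leq_trans w''w' (ltnW w'n).
rewrite leqNgt; apply/negP => w''j.
(* w s_i = w'' s_i s_j s_i *)
have E : (w * g i = w'' * g j * g i * g j)%g.
  by rewrite Ew Ew' -!mulgA; congr (w'' * _)%g; rewrite !mulgA coxeter_gen_braid.
have := lenS (w'' * g j * g i)%g j; rewrite -E => wi'.
have wi2 := leq_trans wi (leq_trans wi' (lenS (w'' * g j)%g i : _.+1 <= _.+2)%N).
have := leq_trans wi2 (w''j : _.+2 <= _.+1)%N.
by rewrite leqNgt (leq_ltn_trans w''w' w'w).
Qed.

Lemma geom_rep_faithful (w : W) : act w = 1%g -> w = 1%g.
Proof.
move=> aw; apply/eqP; apply: contraTT isT => /coxeter_descent[j wj].
have /positive_root/(_ j) : (len (w * g j) <= len (w * g j * g j))%N.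
  by rewrite coxeter_genK ltnW.
rewrite geom_rep_mul_gen reflection_root aw lfunE !mxE !eqxx /= !mulr1.
by rewrite subr_ge0 leNgt ltr1n.
Qed.

End Faithfulness.

(** * Reflections with the Gram matrix of a Coxeter group *)

Section ReflectionRepresentation.
Variables (R : realType) (s : nat) (adj : rel 'I_s) (V : vectType R).
Variables (a : 'I_s -> V) (l : 'I_s -> {linear V -> R^o}).
Hypotheses (adj_sym : symmetric adj) (adj_irr : irreflexive adj).
Hypothesis gram : forall i j, l i (a j) = - 2 * coxeter_mx adj R i j.

(** A reflection without an ambient form: a vector a_i and a functional l_i.
    The curve class group has dimension s + 1, so it carries more than the
    geometric representation, but only the values l_i (a_j) enter the Coxeter
    relations. *)
Definition pseudo_reflection i (v : V) : V := v + (l i v : R) *: a i.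

Lemma pseudo_reflection_linear i : linear (pseudo_reflection i).
Proof.
move=> c u v; rewrite /pseudo_reflection linearP scalerDl -scalerA scalerDr.
by rewrite addrACA.
Qed.
HB.instance Definition _ i :=
  GRing.isLinear.Build R V V _ (pseudo_reflection i) (pseudo_reflection_linear i).

Lemma root_functionalD i (v : V) c j :
  l i (v + c *: a j) = l i v - 2 * c * coxeter_mx adj R i j :> R.
Proof. by rewrite linearD linearZ /= gram; congr (_ + _); rewrite /GRing.scale /=; ring. Qed.

Lemma pseudo_reflectionK i : involutive (pseudo_reflection i).
Proof.
move=> v; rewrite {1}/pseudo_reflection {2}/pseudo_reflection root_functionalD.
rewrite mxE eqxx /pseudo_reflection -addrA -scalerDl.
have E (c : R) : c + (c - 2 * c * 1) = 0 by ring.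
by rewrite E scale0r addr0.
Qed.

Lemma pseudo_reflection_ker i : lker (linfun (pseudo_reflection i)) == 0%VS.
Proof.
by apply/lker0P => u v; rewrite !lfunE /=; apply: inv_inj (pseudo_reflectionK i) _ _.
Qed.

Definition root_reflection i : GL V := MkGL (pseudo_reflection_ker i).

Lemma root_reflectionE i v : root_reflection i v = pseudo_reflection i v.
Proof. by rewrite lfunE. Qed.

Lemma root_reflection_rels u v : coxeter_rel adj u v ->
  word_eval root_reflection u = word_eval root_reflection v.
Proof.
case=> [i|i j ij nij|i j ij]; apply: GL_eqP => x /=;
  rewrite !comp_lfunE !lfunE /=.
- by rewrite pseudo_reflectionK.
- rewrite /pseudo_reflection !root_functionalD !mxE [j == i]eq_sym [adj j i]adj_sym.
  by rewrite (negbTE ij) (negbTE nij) !mulr0 !subr0 addrAC.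
- have ij' : (i == j) = false.
    by apply/eqP => e; move: ij; rewrite e adj_irr.
  rewrite /pseudo_reflection !root_functionalD !mxE ?eqxx.
  rewrite ![j == i]eq_sym ![adj j i]adj_sym ij' ij.
  move: (a i) (a j) (l i x : R) (l j x : R) => p q c d.
  rewrite -!addrA; congr (x + _).
  rewrite [LHS]addrC -[LHS]addrA -scalerDl [LHS]addrC [RHS]addrCA -scalerDl.
  by congr (_ *: _ + _ *: _); field.
Qed.

Definition root_rep : coxeter_group adj -> GL V :=
  @pres_lift _ (coxeter_rel adj) _ root_reflection.

Lemma root_repM : {morph root_rep : u v / (u * v)%g}.
Proof. exact: pres_liftM root_reflection_rels. Qed.

Lemma root_rep_gen i : root_rep (coxeter_gen adj i) = root_reflection i.
Proof. exact: pres_lift_gen root_reflection_rels i. Qed.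

Lemma root_rep1 : root_rep 1%g = 1%g.
Proof. by apply: (mulgI (root_rep 1%g)); rewrite -root_repM !mulg1. Qed.

Lemma root_repV w : root_rep w^-1%g = (root_rep w)^-1%g.
Proof. by apply: (mulgI (root_rep w)); rewrite -root_repM !mulgV root_rep1. Qed.

Definition root_comb (x : 'rV[R]_s) : V := \sum_i x 0 i *: a i.

Lemma root_comb_linear : linear root_comb.
Proof.
move=> c u v; rewrite /root_comb scaler_sumr -big_split /=.
by apply: eq_bigr => i _; rewrite !mxE scalerDl scalerA.
Qed.
HB.instance Definition _ :=
  GRing.isLinear.Build R 'rV[R]_s V _ root_comb root_comb_linear.

Lemma root_comb_root i : root_comb (simple_root R i) = a i.
Proof.
rewrite /root_comb (bigD1 i) //= !mxE !eqxx scale1r big1 ?addr0 // => j ji.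
by rewrite mxE (negbTE ji) andbF scale0r.
Qed.

Lemma root_functional_comb i x :
  l i (root_comb x) = - 2 * coxeter_form adj x (simple_root R i) :> R.
Proof.
rewrite /root_comb linear_sum /coxeter_form /simple_root trmx_delta -colE !mxE mulr_sumr.
apply: eq_bigr => k _; rewrite linearZ /= gram /GRing.scale /= mulrCA; congr (_ * (_ * _)).
by rewrite !mxE eq_sym adj_sym.
Qed.

(** By the Gram matrix, l_i of a combination of the a_k is - 2 B(x, x_i), so
    the intertwining holds for each generator. *)
Lemma root_comb_equivariant w x :
  root_comb (geom_rep R w x) = root_rep w (root_comb x).
Proof.
have [u <-] := gen_prod_surj w.
elim/last_ind: u x => [|u i IH] x.
  by rewrite (_ : gen_prod _ _ = 1%g) // root_rep1 geom_rep1 // !lfunE /=.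
rewrite gen_prod_rcons geom_rep_mul_gen // IH root_repM GL_mulE; congr (root_rep _ _).
rewrite root_rep_gen root_reflectionE /pseudo_reflection root_functional_comb.
by rewrite /reflection_fun linearB linearZ /= root_comb_root mulNr scaleNr.
Qed.

Lemma root_rep_faithful : injective root_comb -> injective root_rep.
Proof.
move=> comb_inj u v uv; apply: divg1_eq; apply: (geom_rep_faithful (R := R)) => //.
apply: GL_eqP => x; apply: comb_inj.
by rewrite root_comb_equivariant root_repM root_repV uv mulgV !lfunE.
Qed.

End ReflectionRepresentation.

(** * The intersection pairing *)

Section Pairing.
Variables (R : realType) (s : nat).
Implicit Types (C : curve R s) (D : divisor R s).

(** Divisor and curve classes have the same coordinates, which makes the
    pairing a symmetric form and gives linearity on the left for free. *)
Lemma pairingC D C : pairing D C = pairing (C : divisor R s) (D : curve R s).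
Proof.
by rewrite /pairing mulrC; congr (_ - _); apply: eq_bigr => i _; rewrite mulrC.
Qed.

Lemma pairingDl D D' C : pairing (D + D') C = pairing D C + pairing D' C.
Proof. by rewrite !(pairingC _ C) linearD. Qed.

Lemma pairingZl c D C : pairing (c *: D) C = c * pairing D C.
Proof. by rewrite !(pairingC _ C) linearZ. Qed.

Lemma pairingBl D D' C : pairing (D - D') C = pairing D C - pairing D' C.
Proof. by rewrite !(pairingC _ C) linearB. Qed.

Lemma pairing_h D : pairing D (curveh R s) = D.1.
Proof. by rewrite /pairing mulr1 big1 ?subr0 // => i _; rewrite mxE mulr0. Qed.

Lemma sum_mul_delta (F : 'I_s -> R) i : \sum_j F j * (j == i)%:R = F i.
Proof.
rewrite (bigD1 i) //= eqxx mulr1 big1 ?addr0 // => j /negbTE ->.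
by rewrite mulr0.
Qed.

Lemma pairing_e D i : pairing D (curvee R i) = D.2 0 i.
Proof.
rewrite /pairing mulr0 sub0r -sumrN -[RHS](sum_mul_delta (D.2 0)).
by apply: eq_bigr => j _; rewrite !mxE eqxx mulrN opprK.
Qed.

Lemma pairing_nondegenerate D : (forall C, pairing D C = 0) -> D = 0.
Proof.
move=> D0; case: D D0 => d m D0; congr pair.
  by rewrite -[LHS](pairing_h (d, m)).
by apply/rowP => i; rewrite mxE -(pairing_e (d, m)).
Qed.

Lemma functional_pairing (f : {linear curve R s -> R^o}) :
  exists D : divisor R s, forall C, pairing D C = f C.
Proof.
exists (f (curveh R s), \row_i f (curvee R i)) => -[d m].
rewrite {2}(pair_coord d m).2 linearB linearZ linear_sum /pairing /= mulrC.
congr (_ - _); apply: eq_bigr => i _.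
by rewrite linearZ mxE mulrC.
Qed.

End Pairing.

(** * Cremona actions and permutations *)

Section Cremona.
Variables (R : realType) (r s : nat).
Implicit Types (C : curve R s) (D : divisor R s) (I : {set 'I_s}).

(** c h - sum_(i in I) e_i or c H - sum_(i in I) E_i: with c = r - 1 the root
    of the Cremona action on curve classes, with c = 1 its coroot.  On divisor
    classes the two exchange their roles. *)
Definition cremona_vec (c : R) I : curve R s := (c, \row_i (i \in I)%:R).

Lemma pairing_cremona_vec c I C :
  pairing (cremona_vec c I : divisor R s) C = c * C.1 - \sum_(i in I) C.2 0 i.
Proof.
rewrite /pairing /=; congr (_ - _); rewrite [RHS]big_mkcond.
by apply: eq_bigr => i _; rewrite mxE; case: ifP; rewrite ?mul1r ?mul0r.
Qed.

Lemma cremona_curveE I C :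
  cremona_curve r I C =
    C + (pairing (cremona_vec 1 I : divisor R s) C : R) *: cremona_vec r.-1%:R I.
Proof.
rewrite pairing_cremona_vec mul1r /cremona_curve; congr pair.
  by congr (_ + _); rewrite mulrC.
apply/rowP => i; rewrite !mxE; case: (i \in I); by rewrite ?mulr1 ?mulr0.
Qed.

Lemma cremona_divisorE I D :
  cremona_divisor r I D =
    D + (pairing D (cremona_vec r.-1%:R I) : R) *: (cremona_vec 1 I : divisor R s).
Proof.
rewrite pairingC pairing_cremona_vec /cremona_divisor; congr pair.
  by congr (_ + _); rewrite [RHS]mulr1.
apply/rowP => i; rewrite !mxE; case: (i \in I); by rewrite ?mulr1 ?mulr0.
Qed.

Lemma cremona_vec_pairing I : (0 < r)%N -> #|I| = r.+1 ->
  pairing (cremona_vec 1 I : divisor R s) (cremona_vec r.-1%:R I) = - 2.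
Proof.
move=> r0 cI; rewrite pairing_cremona_vec mul1r (eq_bigr (fun=> 1)) /=; last first.
  by move=> i iI; rewrite mxE iI.
rewrite sumr_const cI -{2}(prednK r0) -[_.+2]addn2 natrD; ring.
Qed.

(** The cross terms cancel because a reflection and its transpose use the same
    root and coroot, which pair to - 2. *)
Lemma cremona_pairing I D C : (0 < r)%N -> #|I| = r.+1 ->
  pairing (cremona_divisor r I D) (cremona_curve r I C) = pairing D C.
Proof.
move=> r0 cI; rewrite cremona_curveE cremona_divisorE.
rewrite pairingDl pairingZl !linearD !linearZ /= (cremona_vec_pairing r0 cI).
rewrite /GRing.scale /=; ring.
Qed.

Lemma perm_pairing (sigma : 'S_s) D C :
  pairing (perm_divisor sigma D) (perm_curve sigma C) = pairing D C.
Proof.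
rewrite /pairing /=; congr (_ - _).
rewrite (reindex_inj (@perm_inj _ sigma)) /=.
by apply: eq_bigr => i _; rewrite !mxE permK.
Qed.

Lemma card_first_points : (r < s)%N -> #|first_points r s| = r.+1.
Proof.
move=> rs; rewrite -sum1_card (eq_bigl (fun i : 'I_s => i < r.+1)%N) => [|i]; last by rewrite inE.
by rewrite (big_ord_narrow rs) sum1_card card_ord.
Qed.

End Cremona.

(** * The simple roots and their Gram matrix *)

Section SimpleRoots.
Variables (R : realType) (r s : nat).
Hypotheses (hr : (2 <= r)%N) (hs : (r + 3 <= s)%N).
Local Notation adj := (@T_adj r s).

(** For i > 0, the coordinates of e_(i-1) - e_i: a class records the opposites
    of the coefficients of the e_k. *)
Definition simple_diff (i : 'I_s) : 'rV[R]_s :=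
  \row_k ((k == i)%:R - (k.+1 == i :> nat)%:R).

Lemma simple_diffE (k i j : 'I_s) : i = k.+1 :> nat ->
  simple_diff i 0 j = (j == i)%:R - (j == k)%:R.
Proof. by move=> ik; rewrite mxE ik eqSS. Qed.

Lemma sum_simple_diff (F : 'I_s -> R) (k i : 'I_s) : i = k.+1 :> nat ->
  \sum_j F j * simple_diff i 0 j = F i - F k.
Proof.
move=> ik; rewrite -(sum_mul_delta F i) -(sum_mul_delta F k) -sumrB.
by apply: eq_bigr => j _; rewrite (simple_diffE _ ik) mulrBr.
Qed.

Lemma ord_pred_ex (i : 'I_s) : i != 0%N :> nat -> exists k : 'I_s, i = k.+1 :> nat.
Proof.
move=> i0; have lt : (i.-1 < s)%N by rewrite (leq_ltn_trans (leq_pred i)).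
by exists (Ordinal lt); rewrite /= prednK // lt0n.
Qed.

(** The roots for c = r - 1 and the coroots for c = 1: they differ only in the
    degree of the one attached to the Cremona action. *)
Definition class_root (c : R) (i : 'I_s) : curve R s :=
  if i == 0%N :> nat then cremona_vec c (first_points r s) else (0, simple_diff i).

Definition curve_root i := class_root r.-1%:R i.
Definition divisor_root i : divisor R s := class_root 1 i.

Lemma root0E c (i : 'I_s) : i = 0%N :> nat ->
  class_root c i = cremona_vec c (first_points r s).
Proof. by move=> i0; rewrite /class_root i0. Qed.

Lemma rootSE c (i k : 'I_s) : i = k.+1 :> nat -> class_root c i = (0, simple_diff i).
Proof. by move=> ik; rewrite /class_root ik. Qed.

Lemma pairing_rootS c (D : divisor R s) (i k : 'I_s) : i = k.+1 :> nat ->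
  pairing D (class_root c i) = D.2 0 k - D.2 0 i.
Proof.
by move=> ik; rewrite (rootSE c ik) /pairing mulr0 sub0r (sum_simple_diff _ ik) opprB.
Qed.

(** The coefficients of a_0 are constant on I and zero outside, so a_0 pairs
    nontrivially with just one difference e_k - e_i, the one leaving I: this is
    the edge {0, r+1}.  The other edges come from consecutive differences. *)
Lemma class_root_gram i j :
  pairing (divisor_root i) (curve_root j) = - 2 * coxeter_mx adj R i j.
Proof.
have rs : (r < s)%N by lia.
rewrite /divisor_root /curve_root mxE /T_adj /T_edge.
have [i0|i0] := eqVneq (i : nat) 0%N.
  have [j0|j0] := eqVneq (j : nat) 0%N.
    have -> : i = j by apply: val_inj; rewrite /= i0 j0.
    rewrite eqxx (root0E _ j0) (root0E _ j0) mulr1.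
    by rewrite cremona_vec_pairing ?card_first_points //; lia.
  have [k jk] := ord_pred_ex j0.
  rewrite (pairing_rootS _ _ jk) (root0E _ i0) !mxE !inE -val_eqE /= i0 jk /=.
  by rewrite !ltnS eqSS; case: (ltngtP k r) => kr /=; rewrite ?(ltnW kr) /=; field.
have [k ik] := ord_pred_ex i0.
rewrite pairingC; have [j0|j0] := eqVneq (j : nat) 0%N.
  rewrite (pairing_rootS _ _ ik) (root0E _ j0) !mxE !inE -val_eqE /= ik j0 /=.
  by rewrite !ltnS !eqSS; case: (ltngtP k r) => kr /=; rewrite ?(ltnW kr) /=; field.
have [m jm] := ord_pred_ex j0.
rewrite (pairing_rootS _ _ ik) (rootSE _ jm) /= !mxE -!val_eqE /= ik jm /= !eqSS.
case: (ltngtP k m) => km.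
- have -> : (k == m.+1 :> nat) = false by lia.
  by rewrite !orbF [(m : nat) == _]eq_sym; case: (_ == _) => /=; field.
- have -> : (k.+1 == m :> nat) = false by lia.
  have -> : (m == k.+1 :> nat) = false by lia.
  by case: (_ == _) => /=; field.
- have -> : (k.+1 == m :> nat) = false by lia.
  have -> : (k == m.+1 :> nat) = false by lia.
  by rewrite /=; field.
Qed.

End SimpleRoots.

(** * The orthogonal of the canonical class *)

Section CurveRepresentation.
Variables (R : realType) (r s : nat).
Hypotheses (hr : (2 <= r)%N) (hs : (r + 3 <= s)%N).
Local Notation V := (Kperp R r s).
Local Notation adj := (@T_adj r s).
Local Notation K := (canonical_class R r s).
Local Notation root := (curve_root R r (s := s)).

Lemma canonical_classE : K = (- r.+1%:R, const_mx (- r.-1%:R)).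
Proof.
rewrite /canonical_class.
have -> : \sum_i divE R i = (0, const_mx (-1)) :> divisor R s.
  transitivity (- ((0 : R^o), (const_mx 1 : 'rV[R]_s)) : divisor R s).
    rewrite (pair_coord (0 : R) (const_mx 1)).1 scale0r sub0r opprK.
    by apply: eq_bigr => i _; rewrite mxE scale1r.
  by congr pair; rewrite ?oppr0 //; apply/rowP => i; rewrite !mxE.
congr pair; first by rewrite /= scaler0 addr0 [LHS]mulr1.
by apply/rowP => i; rewrite !mxE mulr0 add0r mulrN1.
Qed.

Lemma curve_root_Kperp i : root i \in V.
Proof.
apply/KperpP; have rs : (r < s)%N by lia.
have [i0|/ord_pred_ex[k ik]] := eqVneq (i : nat) 0%N; last first.
  by rewrite (pairing_rootS _ _ _ ik) canonical_classE !mxE subrr.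
rewrite /curve_root (root0E _ _ i0) pairingC pairing_cremona_vec canonical_classE /=.
rewrite (eq_bigr (fun=> - r.-1%:R)) => [|j _]; last by rewrite mxE.
by rewrite sumr_const card_first_points // mulrN mulNrn opprK mulr_natr addNr.
Qed.

Local Notation comb := (root_comb root).

Lemma root_comb_Kperp x : comb x \in V.
Proof. by apply: memv_suml => i _; apply/memvZ/curve_root_Kperp. Qed.

(** Pairing a vanishing combination with H leaves only the coefficient of a_0.
    After that, pairing with sum_(k >= j) E_k extracts the coefficient of a_j,
    as e_(i-1) - e_i has a nonzero partial sum only at j = i. *)
Lemma root_comb_inj : injective comb.
Proof.
apply: raddf_inj => x x0.
have [i0 Ei0] : exists i0 : 'I_s, i0 = 0%N :> nat.
  by have lt : (0 < s)%N by [lia]; exists (Ordinal lt).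
have comb_pairing D : \sum_i x 0 i * pairing D (root i) = 0.
  rewrite -[RHS](linear0 (pairing D)) -x0 linear_sum.
  by apply: eq_bigr => i _; rewrite linearZ.
have xi0 : x 0 i0 = 0.
  have := comb_pairing (divH R s); rewrite (bigD1 i0) //= big1 => [|i ii0].
    rewrite addr0 /curve_root (root0E _ _ Ei0) pairingC pairing_h /=.
    move/eqP; rewrite mulf_eq0 pnatr_eq0.
    have -> : (r.-1 == 0)%N = false by lia.
    by rewrite orbF => /eqP.
  have /ord_pred_ex[k ik] : i != 0%N :> nat.
    by apply: contraNneq ii0 => i0'; apply/eqP/val_inj; rewrite /= i0' Ei0.
  by rewrite (pairing_rootS _ _ _ ik) !mxE subrr mulr0.
apply/rowP => j; rewrite mxE.
have [j0|/ord_pred_ex[m jm]] := eqVneq (j : nat) 0%N.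
  by rewrite (_ : j = i0) //; apply/val_inj; rewrite /= j0 Ei0.
(* The coordinates of sum_(k >= j) E_k. *)
have := comb_pairing (0, \row_k - (j <= k)%:R).
rewrite (bigD1 j) //= big1 => [|i ij].
  by rewrite addr0 (pairing_rootS _ _ _ jm) !mxE jm leqnn ltnn oppr0 sub0r opprK mulr1.
have [i0'|/ord_pred_ex[k ik]] := eqVneq (i : nat) 0%N.
  by rewrite (_ : i = i0) ?xi0 ?mul0r //; apply/val_inj; rewrite /= i0' Ei0.
rewrite (pairing_rootS _ _ _ ik) !mxE ik.
have -> : (j <= k)%N = (j <= k.+1)%N.
  by move/eqP: ij => ij; apply/idP/idP; have : (j <> k.+1 :> nat); [|lia| |lia];
     rewrite -ik => e; apply: ij; apply: val_inj.
by rewrite subrr mulr0.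
Qed.

Lemma canonical_h : pairing K (curveh R s) != 0.
Proof. by rewrite pairing_h canonical_classE /= oppr_eq0 pnatr_eq0. Qed.

Lemma dim_curve : dim (curve R s) = s.+1.
Proof.
have -> : dim (curve R s) = (dim R^o + dim 'rV[R]_s)%N by [].
by rewrite dim_matrix mul1r.
Qed.

(** The functional (K . -) is not zero, so its kernel has codimension one; the
    independent roots supply the opposite inequality. *)
Lemma dim_Kperp : (\dim V <= s)%N.
Proof.
have := limg_ker_dim (linfun (pairing K)) fullv.
rewrite capfv dimvf dim_curve => E.
have : (0 < \dim (limg (linfun (pairing K))))%N.
  rewrite lt0n dimv_eq0; apply: contraNneq canonical_h => im0.
  by rewrite -memv0 -im0 -[pairing _ _](lfunE (pairing K)) memv_img ?memvf.
by move: E; rewrite -/V; lia.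
Qed.

Definition root_iso (x : 'rV[R]_s) : subvs_of V := vsproj V (comb x).
Lemma root_iso_linear : linear root_iso.
Proof. by move=> c x y; rewrite /root_iso !linearP. Qed.
HB.instance Definition _ :=
  GRing.isLinear.Build R 'rV[R]_s (subvs_of V) _ root_iso root_iso_linear.

Lemma vsval_root_iso x : vsval (root_iso x) = comb x.
Proof. by rewrite vsprojK // root_comb_Kperp. Qed.

Lemma root_iso_bij : bijective root_iso.
Proof.
have ker0 : lker (linfun root_iso) == 0%VS.
  apply/lker0P => x y; rewrite !lfunE /= => /(congr1 vsval).
  by rewrite !vsval_root_iso => /root_comb_inj.
have im1 : limg (linfun root_iso) = fullv.
  apply/eqP; rewrite eqEdim subvf /= limg_dim_eq; last first.
    by rewrite (eqP ker0) capv0.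
  by rewrite !dimvf dim_matrix mul1r; exact: dim_Kperp.
exists (linfun root_iso)^-1%VF => x.
  by rewrite -[root_iso x]lfunE lker0_lfunK.
by rewrite -[LHS]lfunE /= limg_lfunVK // im1 memvf.
Qed.

(** * The Weyl group as a Coxeter group *)

Local Notation coroot := (divisor_root R r (s := s)).
Definition coroot_functional i : {linear curve R s -> R^o} := pairing (coroot i).

Lemma functional_gram i j :
  coroot_functional i (root j) = - 2 * coxeter_mx adj R i j.
Proof. exact: class_root_gram. Qed.

Local Notation sym := (@T_adj_sym r s).
Local Notation irr := (@T_adj_irr r s).
Definition curve_rep : coxeter_group adj -> GL (curve R s) := root_rep functional_gram.

Lemma curve_repM : {morph curve_rep : u v / (u * v)%g}.
Proof. exact: root_repM sym irr _. Qed.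

Lemma curve_rep_gen0 (i : 'I_s) : i = 0%N :> nat -> forall C,
  curve_rep (coxeter_gen adj i) C = cremona_curve r (first_points r s) C.
Proof.
move=> i0 C; rewrite /curve_rep (root_rep_gen sym irr) root_reflectionE /pseudo_reflection.
by rewrite cremona_curveE /= /divisor_root /curve_root !root0E.
Qed.

Lemma curve_rep_genS (i k : 'I_s) : i = k.+1 :> nat -> forall C,
  curve_rep (coxeter_gen adj i) C = perm_curve (tperm k i) C.
Proof.
move=> ik C; rewrite /curve_rep (root_rep_gen sym irr) root_reflectionE /pseudo_reflection /=.
rewrite pairingC (pairing_rootS _ _ _ ik) /curve_root (rootSE _ _ ik).
have ki : (k == i) = false by rewrite -val_eqE /= ik ltn_eqF.
congr pair; first by rewrite /= scaler0 addr0.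
apply/rowP => j; rewrite 2!mxE (simple_diffE _ _ ik) mxE tpermV.
case: tpermP => [->|->|/eqP/negbTE-> /eqP/negbTE->].
- by rewrite ki eqxx sub0r mulrN1 opprB addrC subrK.
- by rewrite eqxx [i == k]eq_sym ki subr0 mulr1 addrC subrK.
- by rewrite subrr mulr0 addr0.
Qed.

Definition in_curve_rep (sigma : 'S_s) :=
  exists w, forall C, curve_rep w C = perm_curve sigma C.

Lemma perm_curveM sigma tau C :
  perm_curve (sigma * tau)%g C = perm_curve tau (perm_curve sigma C) :> curve R s.
Proof. by congr pair; apply/rowP => i; rewrite !mxE invMg permM. Qed.

Lemma in_curve_repM sigma tau :
  in_curve_rep sigma -> in_curve_rep tau -> in_curve_rep (sigma * tau)%g.
Proof.
move=> [u uE] [v vE]; exists (v * u)%g => C.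
by rewrite curve_repM GL_mulE uE vE perm_curveM.
Qed.

Lemma in_curve_rep1 : in_curve_rep 1%g.
Proof.
exists 1%g => C; rewrite /curve_rep (root_rep1 sym irr).
by rewrite lfunE /=; case: C => d m; congr pair; apply/rowP => i; rewrite !mxE invg1 perm1.
Qed.

(** Induction on the larger point y: conjugating (x, y - 1) by (y - 1, y) gives
    (x, y). *)
Lemma in_curve_rep_tperm (x y : 'I_s) : in_curve_rep (tperm x y).
Proof.
wlog xy : x y / (x <= y)%N.
  by move=> H; case: (leqP x y) => [/H//|/ltnW/H]; rewrite tpermC.
have [n] := ubnP y; elim: n => // n IH in y xy *; rewrite ltnS => yn.
have [<-|nxy] := eqVneq x y; first by rewrite tperm1; apply: in_curve_rep1.
have /ord_pred_ex[z yz] : y != 0%N :> nat.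
  by apply: contraNneq nxy => y0; apply/eqP/val_inj => /=; lia.
have Hzy : in_curve_rep (tperm z y).
  by exists (coxeter_gen adj y); apply: curve_rep_genS.
have [->//|nxz] := eqVneq x z.
have nzy : z != y by rewrite -val_eqE /= yz ltn_eqF.
have -> : tperm x y = (tperm z y * (tperm x z * tperm z y))%g.
  by rewrite -{1}(tpermV z y) -conjgE tpermJ tpermL tpermD // eq_sym.
apply/in_curve_repM => //; apply/in_curve_repM => //; apply: IH; last by lia.
have : x <> y :> nat by move=> e; case/eqP: nxy; apply: val_inj.
lia.
Qed.

Lemma in_curve_rep_perm sigma : in_curve_rep sigma.
Proof.
have [ts -> _] := prod_tpermP sigma.
elim: ts => [|t ts IH]; first by rewrite big_nil; apply: in_curve_rep1.
by rewrite big_cons; apply: in_curve_repM IH; apply: in_curve_rep_tperm.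
Qed.

Lemma weyl_group_curve_rep g : weyl_group r g <-> exists w, curve_rep w = g.
Proof.
split.
  elim=> {g} [g [gE|[sigma gE]]| |g h _ [u <-] _ [v <-]|g _ [u <-]].
  - have lt0s : (0 < s)%N by lia.
    exists (coxeter_gen adj (Ordinal lt0s)); apply: GL_eqP => C.
    by rewrite gE curve_rep_gen0.
  - have [w wE] := in_curve_rep_perm sigma.
    by exists w; apply: GL_eqP => C; rewrite gE wE.
  - by exists 1%g; rewrite /curve_rep (root_rep1 sym irr).
  - by exists (u * v)%g; rewrite curve_repM.
  - by exists (u^-1)%g; rewrite /curve_rep (root_repV sym irr).
move=> [w <-]; have [u <-] := gen_prod_surj w.
elim/last_ind: u => [|u i IH].
  rewrite (_ : gen_prod _ _ = 1%g) // /curve_rep (root_rep1 sym irr).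
  exact: generated_one.
rewrite gen_prod_rcons curve_repM; apply: generated_mul IH _; apply: generated_in.
have [i0|/ord_pred_ex[k ik]] := eqVneq (i : nat) 0%N.
  by left; apply: curve_rep_gen0.
by right; exists (tperm k i); apply: curve_rep_genS.
Qed.

Lemma curve_rep_inj : injective curve_rep.
Proof.
exact: (root_rep_faithful sym irr root_comb_inj).
Qed.

Lemma root_iso_equivariant w x :
  vsval (root_iso (geom_rep R w x)) = curve_rep w (vsval (root_iso x)).
Proof.
by rewrite !vsval_root_iso (root_comb_equivariant sym irr functional_gram).
Qed.

End CurveRepresentation.

(** * The dual space *)

Section Dual.
Variables (R : realType) (r s : nat).
Local Notation V := (Kperp R r s).
Local Notation K := (canonical_class R r s).
Local Notation Q := (quot_space <[K]>%VS).

(** Since (K . h) is not 0, every C differs from an element of the orthogonal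
    of K by a multiple of h; hence (D . C) is a fixed multiple of (K . C) for
    all C, and the pairing is nondegenerate. *)
Lemma pairing_Kperp_eq0 D : (forall C, C \in V -> pairing D C = 0) -> D \in <[K]>%VS.
Proof.
move=> D0; have Kh := canonical_h R r s; set h := curveh R s in Kh.
apply/vlineP; exists (pairing D h / pairing K h : R).
apply/eqP; rewrite -subr_eq0; apply/eqP/pairing_nondegenerate => C.
rewrite pairingBl pairingZl.
pose C' : curve R s := C - (pairing K C / pairing K h : R) *: h.
have pC' E : pairing E C' = pairing E C - pairing K C / pairing K h * pairing E h.
  by rewrite linearB linearZ.
have /D0 : C' \in V by apply/KperpP; rewrite pC' divfK ?subrr.
by rewrite pC' => <-; congr (_ - _); ring.
Qed.

Lemma pairing_repr D (C : subvs_of V) :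
  pairing (generic_quotient.repr (quot_class <[K]>%VS D)) (vsval C) = pairing D (vsval C).
Proof.
apply/eqP; rewrite -subr_eq0 -pairingBl.
have /vlineP[c ->] : generic_quotient.repr (quot_class <[K]>%VS D) - D \in <[K]>%VS.
  by rewrite -quot_classP quot_reprK.
by have /KperpP KC := subvsP C; rewrite pairingZl KC mulr0.
Qed.

Definition quot_pairing (x : Q) : 'Hom(subvs_of V, R^o) :=
  linfun (pairing (generic_quotient.repr x) \o vsval).

Lemma quot_pairingE D C : quot_pairing (quot_class <[K]>%VS D) C = pairing D (vsval C).
Proof. by rewrite lfunE /= pairing_repr. Qed.

Lemma quot_pairing_linear : linear quot_pairing.
Proof.
move=> c x y; apply/lfunP => C; rewrite -(quot_reprK x) -(quot_reprK y).
rewrite [c *: quot_class _ _]quot_scaleE -quot_classD quot_pairingE pairingDl pairingZl.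
by rewrite add_lfunE scale_lfunE !quot_pairingE.
Qed.
HB.instance Definition _ :=
  GRing.isLinear.Build R Q 'Hom(subvs_of V, R^o) _ quot_pairing quot_pairing_linear.

Lemma quot_pairing_bij : bijective quot_pairing.
Proof.
have inj : injective quot_pairing.
  apply: raddf_inj => x; rewrite -(quot_reprK x) => x0; apply/eqP.
  have -> : 0 = quot_class <[K]>%VS 0.
    by rewrite -(scale0r (quot_class _ 0)) [LHS]quot_scaleE scale0r.
  rewrite quot_classP subr0; apply: pairing_Kperp_eq0 => C CV.
  by rewrite -(vsprojK CV) -quot_pairingE x0 lfunE.
(* A functional on the orthogonal of K extends along a projection onto it. *)
have surj f : exists x, quot_pairing x = f.
  have [D DE] := functional_pairing (f \o vsproj V).
  exists (quot_class <[K]>%VS D); apply/lfunP => C.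
  by rewrite quot_pairingE DE /= vsvalK.
pose psi f := sval (cid (surj f)).
have psiK : cancel psi quot_pairing by move=> f; apply: svalP (cid (surj f)).
by exists psi => //; apply: inj_can_sym psiK inj.
Qed.

End Dual.

Theorem proposition4p11 (R : realType) (r s : nat)
    (hr : (2 <= r)%N) (hs : (r + 3 <= s)%N) :
  (exists (rho : coxeter_group (@T_adj r s) -> GL (curve R s))
          (f : {linear 'rV[R]_s -> subvs_of (Kperp R r s)}),
      {morph rho : u v / (u * v)%g} /\
      injective rho /\
      (forall g : GL (curve R s), weyl_group r g <-> exists w, rho w = g) /\
      (forall (i : 'I_s), i = 0%N :> nat -> forall C : curve R s,
          rho (coxeter_gen (@T_adj r s) i) C
          = cremona_curve r (first_points r s) C) /\
      (forall (i k : 'I_s), i = k.+1 :> nat -> forall C : curve R s,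
          rho (coxeter_gen (@T_adj r s) i) C = perm_curve (tperm k i) C) /\
      bijective f /\
      (forall (w : coxeter_group (@T_adj r s)) (x : 'rV[R]_s),
          vsval (f (geom_rep R w x)) = rho w (vsval (f x)))) /\
  (exists Phi : {linear quot_space <[canonical_class R r s]>%VS
                 -> 'Hom(subvs_of (Kperp R r s), R^o)},
      bijective Phi /\
      (forall (D : divisor R s) (C : subvs_of (Kperp R r s)),
          Phi (quot_class <[canonical_class R r s]>%VS D) C
          = pairing D (vsval C)) /\
      (forall (D : divisor R s) (C C' : subvs_of (Kperp R r s)),
          vsval C' = cremona_curve r (first_points r s) (vsval C) ->
          Phi (quot_class <[canonical_class R r s]>%VS
                 (cremona_divisor r (first_points r s) D)) C'
          = Phi (quot_class <[canonical_class R r s]>%VS D) C) /\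
      (forall (sigma : 'S_s) (D : divisor R s)
              (C C' : subvs_of (Kperp R r s)),
          vsval C' = perm_curve sigma (vsval C) ->
          Phi (quot_class <[canonical_class R r s]>%VS
                 (perm_divisor sigma D)) C'
          = Phi (quot_class <[canonical_class R r s]>%VS D) C)).
Proof.
split.
  exists (@curve_rep R r s hr hs), (@root_iso R r s).
  split; first exact: curve_repM.
  split; first exact: curve_rep_inj.
  split; first exact: weyl_group_curve_rep.
  split; first exact: curve_rep_gen0.
  split; first exact: curve_rep_genS.
  split; first exact: root_iso_bij.
  exact: root_iso_equivariant.
exists (@quot_pairing R r s); split; first exact: quot_pairing_bij.
split; first exact: quot_pairingE.
split=> [D C C' CC'|sigma D C C' CC']; rewrite !quot_pairingE CC'.
  by apply: cremona_pairing; [lia|apply: card_first_points; lia].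
exact: perm_pairing.
Qed.
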